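(* Let $X=\partial T$ be the boundary of a rooted tree $T$ in which every node has at least two children, equipped with the ultrametric $\rho$ and a $\sigma$-finite Borel measure $m$, let $1<p<+\infty$, and let $K(x,y)=K(\rho(x,y))$ be a radial kernel on $X$ with $\|K\|_1<+\infty$ (see context). There exists a constant $A$, depending only on $K$, $\partial T$ and $p$, such that the following holds. For every countable family of balls $\{B_\rho(x_j,r_j)\}_j$ in $X$, with $x_j\in X$, $r_j>0$, such that $\eta_p(x_j,r_j)$ exists for all $j$ and such that the family $\{B_\rho(x_j,\eta_p^*(x_j,r_j))\}_j$ is pairwise disjoint, and for all compact sets $E_j$ with $E_j\subseteq B_\rho(x_j,r_j)$, one has $$\sum_j C_{K,p}(E_j)\le A\cdot C_{K,p}\Big(\bigcup_j E_j\Big).$$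
   Context: $T$ is a tree with root $o$ in which every node has at least 2 children; $X=\partial T$ is the set of infinite geodesics starting at $o$. For a fixed $0<\delta<1$, $\rho(x,y)=\delta^{n(x,y)}$, where $n(x,y)\in\mathbb N\cup\{+\infty\}$ is the number of edges shared by the geodesics connecting $o$ to $x$ and to $y$ (so $\rho(x,x)=0$; here $0\in\mathbb N$). $B_\rho(x,r)=\{y\in X: \rho(x,y)<r\}$. $m$ is a $\sigma$-finite Borel measure on $X$. Kernel: let $\mathcal D=\{0\}\cup\{\delta^n: n\in\mathbb N\}$ and let $K:\mathcal D\to\mathbb R^+$ be a function, lower semicontinuous at $0$, i.e. $\liminf_{n\to+\infty}K(\delta^n)\ge K(0)$; one writes $K(x,y):=K(\rho(x,y))$ for $x,y\in X$. It is assumed that $$\|K\|_1:=\max\Big\{\sup_{x\in X}\int_X K(x,y)\,dm(y),\ \sup_{y\in X}\int_X K(x,y)\,dm(x)\Big\}<+\infty.$$ Capacity: for $E\subseteq X$, $$C_{K,p}(E):=\inf\big\{\|f\|^p_{L^p(X,m)} : f\in L^p(X,m),\ K*f(x)\ge 1\ \ \forall x\in E\big\},\qquad K*f(x):=\int_X K(x,y)f(y)\,dm(y).$$ Radii: for $x\in X$, $r>0$, $$\eta_p(x,r):=\inf\big\{\delta^{n-\frac12} : n\in\mathbb N,\ m(B_\rho(x,\delta^{n-\frac12}))\ge C_{K,p}(B_\rho(x,r))\big\},$$ which is said to exist when the set on the right is non-empty, and $\eta_p^*(x,r):=\max\{r,\eta_p(x,r)\}$. *)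

(* Defs.v *)
From HB Require Import structures.
From mathcomp Require Import all_boot all_order all_algebra.
From mathcomp Require Import finmap.
From mathcomp Require Import all_classical all_reals all_analysis.

Set Implicit Arguments.
Unset Strict Implicit.
Unset Printing Implicit Defensive.

Import Order.TTheory GRing.Theory Num.Theory.
Import numFieldNormedType.Exports.

Local Open Scope classical_set_scope.
Local Open Scope ring_scope.

(* [geodesic e u s] : the vertex sequence [u :: s] is a shortest path of the
   graph [e] between its end points. *)
Definition geodesic (V : eqType) (e : rel V) (u : V) (s : seq V) : Prop :=
  path e u s /\
  forall t : seq V, path e u t -> last u t = last u s -> (size s <= size t)%N.

Definition child (V : eqType) (e : rel V) (o v w : V) : Prop :=
  exists2 s : seq V, geodesic e o (rcons s w) & last o s = v.

(* The vertex set is arbitrary: no local finiteness or countability.  The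
   bound [2] in [tree_acyclic] is there because [:: u; v] is a [ucycle] as soon
   as u and v are adjacent. *)
Record branching_tree := BranchingTree {
  node :> choiceType ;
  adj : rel node ;
  root : node ;
  adj_sym : symmetric adj ;
  adj_irr : irreflexive adj ;
  tree_connected : forall u v : node, exists2 s, path adj u s & last u s = v ;
  tree_acyclic : forall c : seq node, ucycle adj c -> (size c <= 2)%N ;
  tree_branching : forall v : node, exists w1 w2 : node,
    [/\ w1 != w2, child adj root v w1 & child adj root v w2]
}.

Definition is_ray (T : branching_tree) (x : nat -> T) : Prop :=
  x 0%N = root T /\
  forall n, geodesic (@adj T) (root T) (mkseq (fun k => x k.+1) n).

Record ray (T : branching_tree) :=
  Ray { ray_node :> nat -> T ; rayP : is_ray ray_node }.

Definition edge_of (T : branching_tree) (x : ray T) (k : nat) : {fset T} :=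
  [fset x k; x k.+1]%fset.

Definition shared_edges (T : branching_tree) (x y : ray T) : set {fset T} :=
  range (edge_of x) `&` range (edge_of y).

(* delta ^ n(x, y), with n(x, y) the number of shared edges and
   delta ^ +oo = 0 *)
Definition rho (R : realType) (delta : R) (T : branching_tree) (x y : ray T) :
    R :=
  if `[< finite_set (shared_edges x y) >]
  then delta ^+ #|` fset_set (shared_edges x y)| else 0.

Section rays.
Variable T : branching_tree.
Implicit Types x y z : ray T.

Lemma ray_inj x y : x =1 y -> x = y.
Proof.
case: x y => [x px] [y py] /= /funext xy; subst y.
by congr Ray; exact: Prop_irrelevance.
Qed.

Lemma ray0 x : x 0%N = root T. Proof. by case: (rayP x). Qed.

Lemma last_mkseq x n : last (root T) (mkseq (fun k => x k.+1) n) = x n.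
Proof.
case: n => [|n]; first by rewrite /= ray0.
by rewrite mkseqS last_rcons.
Qed.

Lemma ray_adj x k : adj (x k) (x k.+1).
Proof.
have [_ /(_ k.+1)[+ _]] := rayP x.
by rewrite mkseqS rcons_path last_mkseq => /andP[].
Qed.

Lemma ray_level x y i j : x i = y j -> i = j.
Proof.
suff H (x' y' : ray T) a b : x' a = y' b -> (a <= b)%N.
  by move=> xy; apply/eqP; rewrite eqn_leq (H x y)// (H y x).
move=> xy; have [_ /(_ a)[_ Ha]] := rayP x'.
have [_ /(_ b)[Hb _]] := rayP y'.
by have := Ha _ Hb; rewrite !last_mkseq !size_mkseq; exact.
Qed.

Let path_ray x j n : path (@adj T) (x j) [seq x i | i <- iota j.+1 n].
Proof. by elim: n j => //= n IH j; rewrite ray_adj IH. Qed.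

Let last_ray x j n : last (x j) [seq x i | i <- iota j.+1 n] = x (j + n)%N.
Proof. by elim: n j => [|n IH] j /=; rewrite ?addn0// IH addSnnS. Qed.

Let path_rev_ray x j n :
  path (@adj T) (x (j + n)%N) (rev [seq x i | i <- iota j n]).
Proof.
elim: n => [//|n IH]; rewrite -[in iota _ _]addn1 iotaD map_cat rev_cat.
by rewrite /= addnS adj_sym ray_adj IH.
Qed.

Let last_rev_ray x j n d :
  last d (rev [seq x i | i <- iota j n.+1]) = x j.
Proof. by rewrite /= rev_cons last_rcons. Qed.

(* A node of a tree has a unique geodesic to the root. *)
Lemma ray_prefix x y k i : x k = y k -> (i <= k)%N -> x i = y i.
Proof.
move: i; suff step n : x n.+1 = y n.+1 -> x n = y n.
  elim: k => [|k IH] xy i; rewrite leq_eqVlt => /predU1P[->//|]//.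
  by apply: IH; exact: step.
move=> xyS; apply: contrapT => xyn.
have [j /andP[xyj jn] jmax] : exists2 j, (x j == y j) && (j <= n)%N &
    forall i, (x i == y i) && (i <= n)%N -> (i <= j)%N.
  have ex : exists i, (x i == y i) && (i <= n)%N by exists 0%N; rewrite !ray0 eqxx.
  have ub i : (x i == y i) && (i <= n)%N -> (i <= n)%N by case/andP.
  by case: (ex_maxnP ex ub) => j ? ?; exists j.
have {}jn : (j < n)%N.
  by rewrite ltn_neqAle jn andbT; apply/negP => /eqP jn'; move: xyj; rewrite jn' => /eqP.
have xyneq i : (j < i <= n)%N -> x i != y i.
  move=> /andP[ji iN]; apply/negP => /eqP xyi.
  by have := jmax i; rewrite xyi eqxx iN leqNgt ji => /(_ isT).
pose s1 := [seq x i | i <- iota j.+1 (n.+1 - j)].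
pose s2 := rev [seq y i | i <- iota j.+1 (n - j)].
have xj := eqP xyj.
have s1E : x j :: s1 = [seq x i | i <- iota j (n.+1 - j).+1] by [].
have jnE : (j.+1 + (n - j) = n.+1)%N by rewrite addSn subnKC// ltnW.
have /tree_acyclic : ucycle (@adj T) (x j :: s1 ++ s2).
  apply/andP; split.
    rewrite /= rcons_path cat_path last_cat path_ray last_ray.
    rewrite subnKC ?(leq_trans (ltnW jn))// xyS -[in y n.+1]jnE path_rev_ray.
    have [d dE] : exists d, (n - j = d.+1)%N.
      by exists (n - j).-1; rewrite prednK// subn_gt0.
    by rewrite /s2 dE last_rev_ray xj adj_sym ray_adj.
  rewrite -cat_cons cat_uniq rev_uniq s1E; apply/and3P; split.
  - by rewrite map_inj_uniq ?iota_uniq// => a b /ray_level.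
  - apply/hasPn => y'; rewrite mem_rev => /mapP[b + ->].
    rewrite mem_iota jnE ltnS => jb.
    apply/negP => /mapP[a _ yx].
    have ba := ray_level yx; have := xyneq b jb.
    by rewrite yx ba eqxx.
  - by rewrite map_inj_uniq ?iota_uniq// => a b /ray_level.
rewrite /= size_cat size_rev !size_map !size_iota ltnS.
have := jn; rewrite -subn_gt0 subSn ?(ltnW jn)//.
by case: (n - j)%N => // d _; rewrite addSn addnS.
Qed.

Lemma ray_split x y : x <> y ->
  exists n, forall i, (x i = y i) <-> (i <= n)%N.
Proof.
move=> xy.
have ex : exists i, x i != y i.
  apply: contrapT => H; apply/xy/ray_inj => i.
  by apply/eqP/negPn/negP => xyi; apply: H; exists i.
case: (ex_minnP ex) => -[|n]; first by rewrite !ray0 eqxx.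
move=> /eqP xyn nmin; exists n => i; split.
  by move=> xyi; rewrite leqNgt; apply/negP => /(ray_prefix xyi).
by move=> iN; apply/eqP; apply: contraLR iN => /nmin; rewrite -ltnNge.
Qed.

Lemma edge_of_inj x y i j : edge_of x i = edge_of y j ->
  i = j /\ x i.+1 = y i.+1.
Proof.
move=> /fsetP xy.
have mxi : x i \in edge_of y j by rewrite -xy !inE eqxx.
have mxi1 : x i.+1 \in edge_of y j by rewrite -xy !inE eqxx orbT.
move: mxi mxi1; rewrite !inE.
case/orP => /eqP /ray_level ->; case/orP => /eqP e;
  have /eqP := ray_level e; rewrite ?eqSS.
- by rewrite gtn_eqF.
- by move=> _; rewrite e.
- by rewrite gtn_eqF// ltnW.
- by rewrite gtn_eqF.
Qed.

Lemma shared_edgesE x y n : (forall i, (x i = y i) <-> (i <= n)%N) ->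
  shared_edges x y = edge_of x @` `I_n.
Proof.
move=> xyn; apply/seteqP; split=> [e [[i _ <-] [j _ /esym/edge_of_inj[_ h]]]|].
  by exists i => //=; apply/xyn.
move=> _ [i /= ilt <-]; split; first by exists i.
by exists i => //; rewrite /edge_of; congr [fset _; _]%fset;
  apply/esym/xyn => //; exact: ltnW.
Qed.

Section rho_theory.
Variables (R : realType) (delta : R).
Hypothesis delta01 : 0 < delta < 1.

Lemma rhoE x y n : (forall i, (x i = y i) <-> (i <= n)%N) ->
  rho delta x y = delta ^+ n.
Proof.
move=> /shared_edgesE xyn.
have fin : finite_set (shared_edges x y).
  by rewrite xyn; exact/finite_image/finite_II.
rewrite /rho asboolT// xyn; congr (_ ^+ _); apply: card_fset_set.
by apply: inj_card_eq => i j _ _ /edge_of_inj[].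
Qed.

Lemma rhoxx x : rho delta x x = 0.
Proof.
rewrite /rho asboolF// /shared_edges setIid => fin; apply: infinite_nat.
rewrite -(preimage_range (edge_of x)); apply: finite_preimage fin.
by move=> i j _ _ /edge_of_inj[].
Qed.

Lemma rho_sym x y : rho delta x y = rho delta y x.
Proof. by rewrite /rho /shared_edges setIC. Qed.

Let delta_gt0 : 0 < delta. Proof. by case/andP: delta01. Qed.

Lemma rho_ge0 x y : 0 <= rho delta x y.
Proof. by rewrite /rho; case: ifP => // _; rewrite exprn_ge0// ltW. Qed.

Lemma rho_eq0 x y : rho delta x y = 0 -> x = y.
Proof.
move=> xy0; apply: contrapT => /ray_split[n /rhoE xyn].
by move: xy0; rewrite xyn => /eqP; rewrite expf_eq0 gt_eqF// andbF.
Qed.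

Lemma rho_ultra y x z :
  rho delta x z <= Num.max (rho delta x y) (rho delta y z).
Proof.
have [->|xz] := pselect (x = z); first by rewrite rhoxx le_max rho_ge0.
have [->|xy] := pselect (x = y); first by rewrite le_max lexx orbT.
have [->|yz] := pselect (y = z); first by rewrite le_max lexx.
have [n xzn] := ray_split xz; have [k xyk] := ray_split xy.
have [l yzl] := ray_split yz.
rewrite (rhoE xzn) (rhoE xyk) (rhoE yzl) le_max.
have mon a b : (a <= b)%N -> delta ^+ b <= delta ^+ a.
  by apply: ler_wiXn2l; [exact: ltW|apply: ltW; case/andP: delta01].
have : (minn k l <= n)%N.
  apply/xzn; transitivity (y (minn k l)); first by apply/xyk; rewrite geq_minl.
  by apply/yzl; rewrite geq_minr.
by rewrite geq_min => /orP[] /mon ->; rewrite ?orbT.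
Qed.

Lemma rho_triangle y x z :
  rho delta x z <= rho delta x y + rho delta y z.
Proof.
apply: (le_trans (rho_ultra y x z)).
by rewrite ge_max lerDl lerDr !rho_ge0.
Qed.

End rho_theory.
End rays.

Section ray_exists.
Variable T : branching_tree.

Let succ (v : T) : {w : T | child (@adj T) (root T) v w}.
Proof.
apply: cid; have [w [_ [_ ? _]]] := tree_branching v.
by exists w.
Qed.

Let walk (n : nat) : T := iter n (fun v => sval (succ v)) (root T).

Lemma walk_is_ray : is_ray walk.
Proof.
split=> // n; elim: n => [|n [pn minn]]; first by split.
have lastw : last (root T) (mkseq (fun k => walk k.+1) n) = walk n.
  by case: n {pn minn} => // n; rewrite mkseqS last_rcons.
have [s [ps mins] slast] := svalP (succ (walk n)).
rewrite -/(walk n.+1) in ps mins; rewrite mkseqS.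
split.
  move: ps; rewrite !rcons_path slast => /andP[_ aw].
  by rewrite pn lastw.
move=> t pt; rewrite last_rcons => tl.
have := mins t pt; rewrite last_rcons => /(_ tl); apply: leq_trans.
rewrite !size_rcons ltnS; apply: minn; last by rewrite lastw slast.
by move: ps; rewrite rcons_path => /andP[].
Qed.

End ray_exists.

(* [ray T] as a metric space for [rho delta], with its Borel sigma-algebra;
   [delta] and [delta01] only serve to infer these structures. *)
Definition boundary (R : realType) (delta : R) (delta01 : 0 < delta < 1)
  (T : branching_tree) : Type := ray T.

Section boundary_metric.
Context (R : realType) (delta : R) (delta01 : 0 < delta < 1).
Variable T : branching_tree.
Local Notation X := (boundary delta01 T).

HB.instance Definition _ := gen_eqMixin X.
HB.instance Definition _ := gen_choiceMixin X.
HB.instance Definition _ := isPointed.Build X (Ray (walk_is_ray T)).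
HB.instance Definition _ := @isMetric.Build R X (@rho R delta T)
  (@rhoxx T R delta) (@rho_eq0 T R delta delta01) (@rho_sym T R delta)
  (@rho_triangle T R delta delta01).

Lemma mdist_boundary (x y : X) : mdist x y = rho delta x y.
Proof. by []. Qed.

HB.instance Definition _ := @isMeasurable.Build (sigma_display (@open X)) X
  <<s @open X >> (@sigma_algebra0 _ setT (@open X)) (@sigma_algebraC X (@open X))
  (@sigma_algebra_bigcup _ setT (@open X)).

End boundary_metric.

Definition dist_values (R : realType) (delta : R) : set R :=
  [set t | t = 0 \/ exists n : nat, t = delta ^+ n].

Section capacity.
Context (R : realType) (delta : R) (delta01 : 0 < delta < 1).
Context (T : branching_tree).
Local Notation X := (boundary delta01 T).
Variables (m : {measure set X -> \bar R}) (K : R -> R).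
Local Open Scope ereal_scope.

(* K(x, y) = K(rho(x, y)): only the values of [K] on [dist_values delta] are
   ever used. *)
Definition kernel (x y : X) : R := K (mdist x y).

Definition kernel_norm1 : \bar R :=
  maxe (ereal_sup [set \int[m]_y (kernel x y)%:E | x in [set: X]])
       (ereal_sup [set \int[m]_x (kernel x y)%:E | y in [set: X]]).

(* When the positive and the negative parts of the integrand both have an
   infinite integral, this is [+oo - +oo = -oo], so that such an [x] does not
   satisfy [1 <= potential f x]. *)
Definition potential (f : X -> R) (x : X) : \bar R :=
  \int[m]_y (kernel x y * f y)%:E.

Definition capacity (p : R) (E : set X) : \bar R :=
  ereal_inf [set 'N[m]_p%:E[EFin \o f] `^ p | f in
    [set f : X -> R | f \in Lfun m p%:E /\
                      forall x, E x -> 1 <= potential f x]].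

Definition eta_radii (p : R) (x : X) (r : R) : set R :=
  [set (delta `^ (n%:R - 2^-1))%R | n in
    [set n : nat | capacity p (ball x r) <=
                   m (ball x (delta `^ (n%:R - 2^-1))%R)]].

Definition eta (p : R) (x : X) (r : R) : R := inf (eta_radii p x r).

Definition eta_star (p : R) (x : X) (r : R) : R := Num.max r (eta p x r).

End capacity.

(* Main.v *)
(* Write [B_j] for the ball of radius [eta_star] around [x_j] and let [f] be
   admissible for the union of the [E_j].  If the potential on [B_j] of the part
   of [f] outside of [B_j] (a constant) is at most [1/2], then
   [C(E_j) <= 2^p int_{B_j} |f|^p], and these integrals add up to at most
   [||f||_p^p].  Otherwise [C(E_j) <= m(B_j)], and [a <= t + t^(1-p) a^p] with
   [t] small compared with [1/||K||_1] gives
   [m(B_j) <= const * m(B_j) int_{~B_j} K(x_j, y) |f(y)|^p dm(y)].  For [y]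
   outside of [B_j], [m(B_j) K(x_j, y)] is the integral of [K(., y)] on [B_j], so
   that summing under the integral bounds the total by
   [const * ||K||_1 ||f||_p^p].  Joint measurability of the kernel, which may
   fail when the tree is uncountable, is never needed. *)
Require Import Defs.
From HB Require Import structures.
From mathcomp Require Import all_boot all_order all_algebra.
From mathcomp Require Import all_classical all_reals all_analysis.
From mathcomp Require Import measurable_realfun ring lra.

Set Implicit Arguments.
Unset Strict Implicit.
Unset Printing Implicit Defensive.

Import Order.TTheory GRing.Theory Num.Theory.
Import numFieldNormedType.Exports.

Local Open Scope classical_set_scope.
Local Open Scope ring_scope.

Lemma le_add_powR (R : realType) (p a t : R) : 1 < p -> 0 <= a -> 0 < t ->
  a <= t + t `^ (1 - p) * a `^ p.
Proof.
move=> p1 a0 t0; have [at_|ta] := leP a t.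
  by rewrite (le_trans at_)// lerDl mulr_ge0 ?powR_ge0.
have a_gt0 := lt_trans t0 ta.
rewrite -[leLHS]add0r lerD ?(ltW t0)//.
have aE : a = a `^ (1 - p) * a `^ p.
  by rewrite -powRD ?subrK ?powRr1 ?ltW// gt_eqF// implybT.
rewrite {1}aE ler_wpM2r ?powR_ge0//.
have -> : 1 - p = - (p - 1) by rewrite opprB.
rewrite !powRN lef_pV2 ?posrE ?powR_gt0//.
by rewrite ge0_ler_powR ?nnegrE ?ltW// subr_gt0.
Qed.

(** * Ultrametric balls and measurability of the radial kernel *)

Section boundary_kernel.
Context (R : realType) (delta : R) (delta01 : 0 < delta < 1).
Context (T : branching_tree).
Local Notation X := (boundary delta01 T).
Implicit Types x y z : X.

Lemma boundary_ball_trans x y z (r : R) :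
  ball x r y -> ball y r z -> ball x r z.
Proof.
rewrite !ballEmdist /= !mdist_boundary => xy yz.
by apply: (le_lt_trans (rho_ultra delta01 y x z)); rewrite gt_max xy.
Qed.

Lemma measurable_boundary_ball x (r : R) : measurable (ball x r).
Proof.
apply: sub_sigma_algebra; rewrite openE => y xy.
have r0 : 0 < r.
  by move: xy; rewrite ballEmdist /=; exact/le_lt_trans/rho_ge0.
apply/nbhs_ballP; exists r => //= z; exact: boundary_ball_trans.
Qed.

(** Ultrametric triangles are isosceles: [x z] is strictly shorter than [x y], so the other two
    sides agree. *)
Lemma mdist_ball_const x z y (s : R) : ball x s z -> ~ ball x s y ->
  mdist z y = mdist x y.
Proof.
rewrite !ballEmdist /= !mdist_boundary => xz /negP; rewrite -leNgt => xy.
have lt := lt_le_trans xz xy.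
apply/le_anti/andP; split.
  rewrite (le_trans (rho_ultra delta01 x z y))// ge_max lexx andbT.
  by rewrite rho_sym ltW.
have := rho_ultra delta01 z x y.
by rewrite le_max leNgt lt.
Qed.

Lemma dist_values_mdist x y : dist_values delta (mdist x y).
Proof.
rewrite mdist_boundary.
have [->|/ray_split[n xyn]] := pselect (x = y).
  by left; exact: rhoxx.
by right; exists n; exact: rhoE.
Qed.

Lemma measurable_mdist_eq x (t : R) : measurable [set y | mdist x y = t].
Proof.
(* A sphere is a closed ball minus an open one, the closed ball being a countable intersection of
   open balls. *)
have -> : [set y | mdist x y = t] =
    (\bigcap_(n : nat) ball x (t + n.+1%:R^-1)) `\` ball x t.
  apply/seteqP; split => y /=.
    move=> <-; split; last by rewrite ballEmdist /= ltxx.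
    by move=> n _; rewrite ballEmdist /= ltrDl.
  move=> [yt]; rewrite ballEmdist /= => /negP; rewrite -leNgt => ty.
  apply/le_anti; rewrite ty andbT; apply/ler_addgt0Pr => e e0.
  have [n ne] : exists n : nat, n.+1%:R^-1 < e.
    exists (Num.truncn e^-1); rewrite invf_plt ?posrE//.
    exact: truncnS_gt.
  have := yt n I; rewrite ballEmdist /= => /ltW /le_trans; apply.
  by rewrite lerD2l ltW.
apply: measurableD; last exact: measurable_boundary_ball.
by apply: bigcapT_measurable => n; exact: measurable_boundary_ball.
Qed.

Variable K : R -> R.

Lemma kernel_sym x y : Defs.kernel K x y = Defs.kernel K y x.
Proof. by rewrite /Defs.kernel !mdist_boundary rho_sym. Qed.

Lemma kernel_ball_const x z y (s : R) : ball x s z -> ~ ball x s y ->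
  Defs.kernel K z y = Defs.kernel K x y.
Proof. by move=> xz xy; rewrite /Defs.kernel (mdist_ball_const xz xy). Qed.

(* [K] itself need not be measurable: only its countably many values on
   [dist_values delta] matter. *)
Lemma measurable_kernel x : measurable_fun [set: X] (Defs.kernel K x).
Proof.
move=> _ Y _; rewrite setTI.
have -> : Defs.kernel K x @^-1` Y =
    (if `[< Y (K 0) >] then [set y | mdist x y = 0] else set0) `|`
    \bigcup_(n in [set n : nat | Y (K (delta ^+ n))])
      [set y | mdist x y = delta ^+ n].
  apply/seteqP; split => y.
    rewrite /Defs.kernel /= => KY; have [d0|[n dn]] := dist_values_mdist x y.
      by left; rewrite -d0 asboolT.
    by right; exists n; rewrite //= -dn.
  move=> [|[n /= KY dn]]; last by rewrite /Defs.kernel /= dn.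
  by case: asboolP => //= KY d0; rewrite /Defs.kernel /= d0.
apply: measurableU; first by case: ifP => // _; exact: measurable_mdist_eq.
by apply: bigcup_measurable => n _; exact: measurable_mdist_eq.
Qed.

End boundary_kernel.

(** * Capacity of one ball, sums over disjoint balls, and the radius [eta_star] *)

Section capacity_bounds.
Context (R : realType) (delta : R) (delta01 : 0 < delta < 1).
Context (T : branching_tree).
Local Notation X := (boundary delta01 T).
Variables (m : {measure set X -> \bar R}) (K : R -> R).
Hypothesis K_ge0 : forall t, dist_values delta t -> 0 <= K t.
Variable p : R.
Hypothesis p_gt1 : 1 < p.
Implicit Types (x y z : X) (E B : set X) (f : X -> R).
Local Open Scope ereal_scope.

Let p_gt0 : (0 < p)%R. Proof. exact: lt_trans p_gt1. Qed.

Lemma kernel_ge0 x y : (0 <= Defs.kernel K x y)%R.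
Proof. exact/K_ge0/dist_values_mdist. Qed.

Lemma LfunP f : f \in Lfun m p%:E <->
  measurable_fun setT f /\ \int[m]_y (`|f y| `^ p)%:E < +oo.
Proof.
have normE : 'N[m]_p%:E[EFin \o f] `^ p = \int[m]_y (`|f y| `^ p)%:E.
  by rewrite poweR_Lnorm ?gt_eqF.
split=> [/andP[]|[mf lty]].
  rewrite !inE /= => mf fin; split=> //.
  by rewrite -normE poweR_lty.
apply/andP; rewrite !inE /=; split=> //.
by rewrite /finite_norm (lty_poweRy (r := p)) ?gt_eqF ?normE.
Qed.

Lemma capacity_le_integral E f : f \in Lfun m p%:E ->
  (forall x, E x -> 1 <= potential m K f x) ->
  capacity m K p E <= \int[m]_y (`|f y| `^ p)%:E.
Proof.
move=> Lf fE; apply: ereal_inf_lbound; exists f => //.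
by rewrite poweR_Lnorm ?gt_eqF.
Qed.

Lemma le_capacity E B : E `<=` B -> capacity m K p E <= capacity m K p B.
Proof.
move=> EB; apply: ereal_inf_le_tmp => _ [f [Lf fB] <-].
by exists f => //; split=> // x /EB/fB.
Qed.

Lemma measurable_kernelM x f : measurable_fun setT f ->
  measurable_fun setT (fun y => (Defs.kernel K x y * f y)%:E).
Proof.
move=> mf; apply/measurable_EFinP.
by apply: measurable_funM => //; exact: measurable_kernel.
Qed.

(** As the kernel is non-negative, [f] may be replaced by its absolute value, so that only integrals
    of non-negative functions remain to be split. *)
Lemma potential_le_norm f x : measurable_fun setT f ->
  1 <= potential m K f x -> 1 <= potential m K (fun y => `|f y|%R) x.
Proof.
move=> mf /le_trans; apply; rewrite /potential.
apply: (le_trans (lee_abs _)).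
apply: (le_trans (le_abse_integral _ _ _)) => //.
  exact: measurable_kernelM.
rewrite le_eqVlt; apply/orP; left; apply/eqP; apply: eq_integral => y _ /=.
by rewrite normrM ger0_norm// kernel_ge0.
Qed.

(* The potential of the part of [f] outside of the ball is constant on the
   ball, because [mdist] is an ultrametric; so either the part of [f] inside the
   ball, doubled, is admissible for [E], or that constant is at least [1/2]. *)
Lemma capacity_ball_le (x : X) (s t M : R) E f :
  (0 < t)%R -> (4 * t * M <= 1)%R ->
  \int[m]_y (Defs.kernel K x y)%:E <= M%:E ->
  E `<=` ball x s -> capacity m K p E <= m (ball x s) ->
  f \in Lfun m p%:E -> (forall z, E z -> 1 <= potential m K f z) ->
  capacity m K p E <=
    (2 `^ p)%:E * \int[m]_(y in ball x s) (`|f y| `^ p)%:E +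
    (4 * t `^ (1 - p))%:E * (m (ball x s) *
       \int[m]_(y in ~` ball x s) (Defs.kernel K x y * `|f y| `^ p)%:E).
Proof.
set B := ball x s => t0 tM kM EB capB Lf fE.
have [mf flty] := (LfunP f).1 Lf.
have mB : measurable B by exact: measurable_boundary_ball.
have mBC : measurable (~` B) by exact: measurableC.
have mnf : measurable_fun setT (fun y => `|f y|%R).
  exact/measurableT_comp.
have mfp : measurable_fun setT (fun y => `|f y| `^ p)%R.
  exact: (measurableT_comp (measurable_powR p)).
set c := \int[m]_(y in ~` B) (Defs.kernel K x y * `|f y|)%:E.
have kf0 z y : 0 <= (Defs.kernel K z y * `|f y|)%:E.
  by rewrite lee_fin mulr_ge0// kernel_ge0.
have kfp0 z y : 0 <= (Defs.kernel K z y * `|f y| `^ p)%:E.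
  by rewrite lee_fin mulr_ge0 ?kernel_ge0 ?powR_ge0.
have fp0 y : 0 <= (`|f y| `^ p)%:E by rewrite lee_fin powR_ge0.
have [c_le|c_gt] := leP c (2^-1)%:E.
  (* The doubling makes up for the outer part: [1 <= u + 1/2] gives [1 <= 2 * u]. *)
  pose g : X -> R := ((fun y => 2 * `|f y|)%R \_ B).
  have mg : measurable_fun setT g.
    apply: (measurable_restrictT _ mB).1; apply: measurable_funTS.
    exact: (measurable_funM (measurable_cst (2%R : R)) mnf).
  have gpE : \int[m]_y (`|g y| `^ p)%:E =
      (2 `^ p)%:E * \int[m]_(y in B) (`|f y| `^ p)%:E.
    rewrite -ge0_integralZl_EFin//; last first.
      by apply: measurable_funTS; exact/measurable_EFinP.
    rewrite integral_mkcond; apply: eq_integral => y _.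
    rewrite /g !patchE; case: ifP => _ /=.
      by rewrite normrM normr_id ger0_norm// powRM.
    by rewrite normr0 powR0// gt_eqF.
  have Lg : g \in Lfun m p%:E.
    apply/LfunP; split=> //; rewrite gpE lte_mul_pinfty ?lee_fin ?powR_ge0//.
    apply: le_lt_trans flty; apply: ge0_subset_integral => //.
    exact/measurable_EFinP.
  apply: le_trans (leeDl _ _); last first.
    rewrite mule_ge0 ?lee_fin ?mulr_ge0 ?powR_ge0// mule_ge0//.
    exact: integral_ge0.
  rewrite -gpE; apply: capacity_le_integral Lg _ => z Ez.
  have Bz := EB _ Ez.
  have potg : potential m K g z =
      2%:E * \int[m]_(y in B) (Defs.kernel K z y * `|f y|)%:E.
    rewrite -ge0_integralZl_EFin//; last first.
      by apply: measurable_funTS; exact: measurable_kernelM.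
    rewrite integral_mkcond; apply: eq_integral => y _.
    rewrite /g !patchE; case: ifP => _ /=; last by rewrite mulr0.
    by rewrite -EFinM; congr EFin; ring.
  rewrite potg; have := potential_le_norm mf (fE _ Ez).
  rewrite /potential -(setUv B) ge0_integral_setU//; last 2 first.
  - by rewrite setUv; exact: measurable_kernelM.
  - by rewrite disj_set2E setICr.
  have -> : \int[m]_(y in ~` B) (Defs.kernel K z y * `|f y|)%:E = c.
    by apply: eq_integral => y; rewrite inE => By; rewrite (kernel_ball_const _ Bz).
  move=> h.
  have : 1 <= \int[m]_(y in B) (Defs.kernel K z y * `|f y|)%:E + (2^-1)%:E.
    by apply: (le_trans h); rewrite leeD2l.
  case: (\int[m]_(y in B) _) => [u| |] //=.
    by rewrite -EFinD -EFinM !lee_fin; lra.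
  by rewrite gt0_muley// ?leey// lte_fin.
apply: (le_trans capB); apply: le_trans (leeDr _ _); last first.
  by rewrite mule_ge0 ?lee_fin ?powR_ge0// integral_ge0.
rewrite muleCA -[leLHS]mule1 lee_wpmul2l//.
set J := \int[m]_(y in ~` B) _.
have cJ : c <= (t * M)%:E + (t `^ (1 - p))%:E * J.
  have mk : measurable_fun setT (fun y => (Defs.kernel K x y)%:E).
    by apply/measurable_EFinP; exact: measurable_kernel.
  apply: (@le_trans _ _ (\int[m]_(y in ~` B)
     (t%:E * (Defs.kernel K x y)%:E +
      (t `^ (1 - p))%:E * (Defs.kernel K x y * `|f y| `^ p)%:E))).
    apply: ge0_le_integral => //.
    - by apply: measurable_funTS; exact: measurable_kernelM.
    - apply: measurable_funTS; apply: emeasurable_funD.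
        exact: measurable_funeM.
      by apply: measurable_funeM; exact: measurable_kernelM.
    - move=> y _; rewrite -!EFinM -EFinD lee_fin.
      rewrite [X in (_ <= X)%R](_ : _ = Defs.kernel K x y *
        (t + t `^ (1 - p) * `|f y| `^ p))%R; last by ring.
      by rewrite ler_wpM2l ?kernel_ge0// le_add_powR.
  rewrite ge0_integralD//; last 4 first.
  - by move=> y _; rewrite -EFinM lee_fin mulr_ge0 ?kernel_ge0 ?ltW.
  - by apply: measurable_funTS; exact: measurable_funeM.
  - by move=> y _; rewrite mule_ge0// lee_fin powR_ge0.
  - by apply: measurable_funTS; apply: measurable_funeM; exact: measurable_kernelM.
  rewrite !ge0_integralZl_EFin ?powR_ge0 ?(ltW t0)//; last 3 first.
  - by apply: measurable_funTS; exact: measurable_kernelM.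
  - by move=> y _; rewrite lee_fin kernel_ge0.
  - exact: measurable_funTS.
  rewrite leeD// EFinM lee_wpmul2l ?lee_fin ?(ltW t0)//.
  apply: le_trans kM; apply: ge0_subset_integral => // y _.
  by rewrite lee_fin kernel_ge0.
have J0 : 0 <= J by exact: integral_ge0.
(* Since [t * M <= 1/4] and [c > 1/2], the term in [J] exceeds [1/4]; hence the factor [4]. *)
have := lt_le_trans c_gt cJ.
case: J J0 {cJ} => [u| |] // u0.
  rewrite -!EFinM -EFinD lte_fin lee_fin -mulrA.
  move: (_ * u)%R => v; lra.
by move=> _; rewrite gt0_muley ?leey// lte_fin mulr_gt0 ?powR_gt0.
Qed.


Lemma sum_measure_ball_le (I : eqType) (F : seq I) (x : I -> X) (s : I -> R)
    (M : R) (g : X -> R) :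
  uniq F -> trivIset [set` F] (fun j => ball (x j) (s j)) ->
  (forall x, \int[m]_y (Defs.kernel K x y)%:E <= M%:E) ->
  measurable_fun setT g -> (forall y, 0 <= g y)%R ->
  \sum_(j <- F) m (ball (x j) (s j)) *
      \int[m]_(y in ~` ball (x j) (s j)) (Defs.kernel K (x j) y * g y)%:E <=
    M%:E * \int[m]_y (g y)%:E.
Proof.
move=> uF tF kM mg g0; pose B j : set X := ball (x j) (s j).
have mB j : measurable (B j) by exact: measurable_boundary_ball.
have mBC j : measurable (~` B j) by exact: measurableC.
have kg0 z y : 0 <= (Defs.kernel K z y * g y)%:E.
  by rewrite lee_fin mulr_ge0// kernel_ge0.
have M0 : (0 <= M)%R.
  rewrite -lee_fin; apply: le_trans (kM point); apply: integral_ge0 => y _.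
  by rewrite lee_fin kernel_ge0.
pose h j := (fun y => (Defs.kernel K (x j) y * g y)%:E) \_ (~` B j).
have h0 j y : 0 <= h j y by rewrite /h patchE; case: ifP.
have mh j : measurable_fun setT (h j).
  apply: (measurable_restrictT _ (mBC j)).1; apply: measurable_funTS.
  exact: measurable_kernelM.
(* Both sides become integrals in [y], to be compared pointwise; only a finite sum and an integral
   are exchanged. *)
rewrite (eq_bigr (fun j => \int[m]_y (m (B j) * h j y))); last first.
  by move=> j _; rewrite integral_mkcond -/(h j) ge0_integralZl.
rewrite -ge0_integral_sum//; last 2 first.
- by move=> j; exact: measurable_funeM.
- by move=> j y _; rewrite mule_ge0.
rewrite -ge0_integralZl_EFin//; last 2 first.
- by move=> y _; rewrite lee_fin.
- exact/measurable_EFinP.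
have mk y : measurable_fun setT (fun z => (Defs.kernel K z y)%:E).
  apply/measurable_EFinP; rewrite (_ : (fun z => _) = Defs.kernel K y).
    exact: measurable_kernel.
  by apply/funext => z; rewrite kernel_sym.
apply: ge0_le_integral => //.
- by move=> y _; apply: sume_ge0 => j _; rewrite mule_ge0.
- by apply: emeasurable_sum => j; exact: measurable_funeM.
- by apply: measurable_funeM; exact/measurable_EFinP.
move=> y _.
apply: (@le_trans _ _
    (\sum_(j <- F) (g y)%:E * \int[m]_(z in B j) (Defs.kernel K z y)%:E)).
  apply: lee_sum => j _; rewrite /h patchE; case: ifPn => [|_]; last first.
    rewrite mule0 mule_ge0 ?lee_fin// integral_ge0// => z _.
    by rewrite lee_fin kernel_ge0.
  rewrite inE => By; rewrite muleC mulrC EFinM -muleA lee_wpmul2l ?lee_fin//.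
  rewrite -integral_cst//; apply: ge0_le_integral => //.
  - by move=> z _; rewrite lee_fin kernel_ge0.
  - exact: measurable_funTS.
  - by move=> z Bz; rewrite (kernel_ball_const K Bz By).
rewrite -ge0_sume_distrr; last first.
  by move=> j _; apply: integral_ge0 => z _; rewrite lee_fin kernel_ge0.
rewrite muleC lee_wpmul2r ?lee_fin//.
rewrite -ge0_integral_bigsetU//; last 2 first.
- exact: measurable_funTS.
- by move=> z _; rewrite lee_fin kernel_ge0.
(* By disjointness the integrals over the [B j] add up to one over their union, and symmetry of the
   kernel gives the bound [M]. *)
apply: le_trans (kM y); under [leRHS]eq_integral do rewrite kernel_sym.
apply: ge0_subset_integral => //.
- exact: bigsetU_measurable.
- by move=> z _; rewrite lee_fin kernel_ge0.
Qed.

(* The infimum [eta] need not belong to [eta_radii], but the radii cannot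
   accumulate at a positive infimum; so some radius is at most [eta_star]. *)
Lemma capacity_le_measure_eta_star x (r : R) : (0 < r)%R ->
  eta_radii m K p x r !=set0 ->
  capacity m K p (ball x r) <= m (ball x (eta_star m K p x r)).
Proof.
move=> r0 S0; have /andP[delta_gt0 delta_lt1] := delta01.
have delta01' : (0 < delta <= 1)%R by rewrite delta_gt0 ltW.
set S := eta_radii m K p x r in S0.
have lb0 : lbound S 0%R by move=> _ [n _ <-]; exact: powR_ge0.
have infS : has_inf S by split=> //; exists 0%R.
suff [u [n capn un] us] : exists2 u, S u & (u <= eta_star m K p x r)%R.
  apply: (le_trans capn); rewrite le_measure ?inE//;
    [exact: measurable_boundary_ball..|].
  by apply: le_ball; rewrite un.
have [lt_r|r_le] := ltP (inf S) r.
  have [|u Su] := inf_adherent (eps := r - inf S) _ infS; first by rewrite subr_gt0.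
  rewrite addrC subrK => ur; exists u => //.
  by rewrite le_max ltW.
have inf0 := lt_le_trans r0 r_le.
(* This [eps] gives [u < inf S / delta]. The radii lie in a geometric progression of ratio [delta],
   so a radius below [u] would be at most [delta * u < inf S]; thus [u] is the least radius. *)
have [|u Su] := inf_adherent (eps := inf S * (delta^-1 - 1)) _ infS.
  by rewrite mulr_gt0// subr_gt0 invf_gt1.
rewrite mulrBr mulr1 addrC subrK => u_lt; exists u => //.
rewrite le_max; apply/orP; right; apply: lb_le_inf => // v Sv.
rewrite leNgt; apply/negP => vu.
suff : (v <= delta * u)%R.
  rewrite leNgt => /negP; apply.
  apply: lt_le_trans (ge_inf infS.2 Sv).
  by rewrite mulrC -ltr_pdivlMr.
move: Su Sv vu => [n _ <-] [k _ <-] vu.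
have nk : (n < k)%N.
  rewrite ltnNge; apply/negP => kn; move: vu; rewrite ltNge => /negP; apply.
  by apply: ger_powR; rewrite ?delta01' ?lerD2r ?ler_nat.
have -> : (delta * delta `^ (n%:R - 2^-1) = delta `^ (1 + (n%:R - 2^-1)))%R.
  by rewrite [RHS]powRD ?(gt_eqF delta_gt0) ?implybT ?(powRr1 (ltW delta_gt0)).
by apply: ger_powR; rewrite // addrA lerD2r nat1r ler_nat.
Qed.

End capacity_bounds.

(** * Choice of the constant and summation over the family of balls *)

Theorem theorem0p2 (R : realType) (T : branching_tree)
    (delta : R) (delta01 : 0 < delta < 1)
    (m : {measure set (boundary delta01 T) -> \bar R})
    (m_sigma_finite : sigma_finite [set: boundary delta01 T] m)
    (p : R) (p_gt1 : 1 < p)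
    (K : R -> R)
    (K_ge0 : forall t, dist_values delta t -> 0 <= K t)
    (K_lsc0 : ((K 0)%:E <= limn_einf (fun n : nat => (K (delta ^+ n))%:E))%E)
    (K_norm1 : (kernel_norm1 m K < +oo)%E) :
  exists2 A : R, 0 < A &
    forall (I : countType) (x : I -> boundary delta01 T) (r : I -> R)
        (E : I -> set (boundary delta01 T)),
      (forall j, 0 < r j) ->
      (forall j, eta_radii m K p (x j) (r j) !=set0) ->
      trivIset [set: I] (fun j => ball (x j) (eta_star m K p (x j) (r j))) ->
      (forall j, compact (E j)) ->
      (forall j, E j `<=` ball (x j) (r j)) ->
      (\esum_(j in [set: I]) capacity m K p (E j) <=
         A%:E * capacity m K p (\bigcup_(j in [set: I]) E j))%E.
Proof.
have [p0 powp0] : 0 < p /\ 0 < 2 `^ p.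
  by split; [exact: lt_trans p_gt1|exact: powR_gt0].
pose M := fine (kernel_norm1 m K).
have kM x : (\int[m]_y (Defs.kernel K x y)%:E <= M%:E)%E.
  have kN : (\int[m]_y (Defs.kernel K x y)%:E <= kernel_norm1 m K)%E.
    by rewrite /kernel_norm1 le_max ereal_sup_ubound//; exists x.
  rewrite /M fineK// ge0_fin_numE// (le_trans _ kN)// integral_ge0// => y _.
  by rewrite lee_fin kernel_ge0.
have M0 : 0 <= M.
  rewrite -lee_fin; apply: le_trans (kM point); apply: integral_ge0 => y _.
  by rewrite lee_fin kernel_ge0.
(* This ensures [4 * t * M <= 1]; the [+ 1] covers [M = 0]. *)
pose t := (4 * (M + 1))^-1.
have t0 : 0 < t by rewrite invr_gt0 mulr_gt0// ltr_wpDl.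
have tM : 4 * t * M <= 1.
  rewrite /t invfM mulrA mulfV// mul1r mulrC ler_pdivrMr ?mul1r ?lerDl//.
  by rewrite ltr_wpDl.
pose C := 4 * t `^ (1 - p).
have C0 : 0 <= C by rewrite mulr_ge0 ?powR_ge0.
have A0 : 0 < 2 `^ p + C * M by exact: ltr_wpDr (mulr_ge0 C0 M0) powp0.
exists (2 `^ p + C * M) => // I x r E r0 Sne tB _ EB.
(* Dividing by the positive constant reduces the claim to a bound for each [f] admissible for the
   union. *)
rewrite -lee_pdivrMl//; apply: le_ereal_inf_tmp => _ [f [Lf fE] <-].
rewrite lee_pdivrMl// poweR_Lnorm ?gt_eqF//.
have [mf _] := (LfunP m p_gt1 f).1 Lf.
have mfp : measurable_fun setT (fun y => `|f y| `^ p).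
  by apply: (measurableT_comp (measurable_powR p)); exact/measurableT_comp.
set s := fun j => eta_star m K p (x j) (r j).
have mB j : measurable (ball (x j) (s j)) by exact: measurable_boundary_ball.
have rs j : ball (x j) (r j) `<=` ball (x j) (s j).
  by apply: le_ball; rewrite le_max lexx.
(* The infinite sum is a supremum over finite subfamilies. *)
apply: ge_ereal_sup => _ [F [finF _] <-]; rewrite fsbig_finite//=.
have := finmap.fset_uniq (fset_set F).
move: (finmap.enum_fset _) => G uG.
have tG : trivIset [set` G] (fun j => ball (x j) (s j)).
  exact: sub_trivIset tB.
apply: (@le_trans _ _ (\sum_(j <- G)
   ((2 `^ p)%:E * \int[m]_(y in ball (x j) (s j)) (`|f y| `^ p)%:E +
    C%:E * (m (ball (x j) (s j)) * \int[m]_(y in ~` ball (x j) (s j))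
       (Defs.kernel K (x j) y * `|f y| `^ p)%:E)))%E).
  apply: lee_sum => j _; apply: capacity_ball_le tM _ _ _ _ _ => //.
  - by move=> y /EB/rs.
  - apply: le_trans (capacity_le_measure_eta_star (r0 j) (Sne j)).
    exact/le_capacity/EB.
  - by move=> z Ez; apply: fE; exists j.
rewrite big_split /= EFinD ge0_muleDl ?lee_fin ?(mulr_ge0 C0 M0) ?(ltW powp0)//.
apply: leeD.
  rewrite -ge0_sume_distrr; last first.
    by move=> j _; apply: integral_ge0 => y _; rewrite lee_fin powR_ge0.
  rewrite lee_wpmul2l ?lee_fin ?(ltW powp0)//.
  rewrite -ge0_integral_bigsetU//; last first.
    by apply: measurable_funTS; exact/measurable_EFinP.
  apply: ge0_subset_integral => //.
  - exact: bigsetU_measurable.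
  - exact/measurable_EFinP.
rewrite -ge0_sume_distrr; last first.
  move=> j _; rewrite mule_ge0// integral_ge0// => y _.
  by rewrite lee_fin mulr_ge0 ?kernel_ge0 ?powR_ge0.
rewrite (EFinM C) -muleA lee_wpmul2l ?lee_fin//.
exact: sum_measure_ball_le.
Qed.
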